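(* Suppose $P=\{\mathbf{x}\in\mathbb{R}^n:(\mathbf{x}-\mathbf{c})^T[I-\mathbf{v}\mathbf{v}^T](\mathbf{x}-\mathbf{c})=4c\,\mathbf{v}\cdot(\mathbf{x}-\mathbf{c})\}$ is a paraboloid in $\mathbb{R}^n$ centered at $\mathbf{c}=(c_1,\dots,c_n)^T$, with axis vector $\mathbf{v}$ of unit length and parameter $c$, and suppose that $H\!P=\{\mathbf{x}\in\mathbb{R}^n:\mathbf{h}\cdot(\mathbf{x}-\mathbf{c})=\hat h\}$ is a hyperplane with $\|\mathbf{h}\|=1$. Suppose that $P\cap H\!P$ is nonempty. Let $\rho=\sqrt{1-(\mathbf{h}\cdot\mathbf{v})^2}$. Then $P\cap H\!P$ is a paraboloid of dimension $n-1$ if $\rho=1$, or an ellipsoid of dimension $n-1$ if $\rho<1$.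
   Context: Norms are Euclidean. The paraboloid $P$ is determined by two distinct points $\mathbf{p}_1,\mathbf{p}_2\in\mathbb{R}^n$: it is $\{\mathbf{x}:\|\mathbf{p}_1-\mathbf{x}\|=\mathbf{v}\cdot(\mathbf{x}-\mathbf{p}_2)\}$ with $\mathbf{v}=(\mathbf{p}_1-\mathbf{p}_2)/\|\mathbf{p}_1-\mathbf{p}_2\|$, center (vertex) $\mathbf{c}=\frac12(\mathbf{p}_1+\mathbf{p}_2)$ and $c=\frac12\|\mathbf{p}_1-\mathbf{p}_2\|>0$. Conic sections of dimension $n-1$ are taken inside a hyperplane $A$ of $\mathbb{R}^n$: - a paraboloid is a set $\{\mathbf{x}\in A:\|\mathbf{q}_1-\mathbf{x}\|=\mathbf{w}\cdot(\mathbf{x}-\mathbf{q}_2)\}$ with $\mathbf{q}_1\neq\mathbf{q}_2$ in $A$ and $\mathbf{w}=(\mathbf{q}_1-\mathbf{q}_2)/\|\mathbf{q}_1-\mathbf{q}_2\|$; - an ellipsoid is a set $\{\mathbf{x}\in A:\|\mathbf{q}_2-\mathbf{x}\|+\|\mathbf{q}_1-\mathbf{x}\|=2\alpha\}$ with $\mathbf{q}_1,\mathbf{q}_2\in A$ (possibly equal), $\alpha>0$ and $2\alpha>\|\mathbf{q}_1-\mathbf{q}_2\|$.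
   Formalization: In the case ρ<1 the section P∩HP is additionally assumed not to be a single point; a tangent hyperplane (e.g. h=v, ĥ=0) meets P only in one point, which is not an ellipsoid since 2α>‖q1−q2‖. *)

(* Defs.v *)
From mathcomp Require Import all_boot all_order all_algebra.
From mathcomp Require Import boolp classical_sets reals.
From mathcomp Require Import ring lra.

Set Implicit Arguments.
Unset Strict Implicit.
Unset Printing Implicit Defensive.

Import Order.TTheory GRing.Theory Num.Theory.
Local Open Scope ring_scope.
Local Open Scope classical_set_scope.

Definition dot (R : realType) (n : nat) (u w : 'cV[R]_n) : R :=
  (u^T *m w) ord0 ord0.

(* The norm `|_| that the library puts on matrices is the sup norm. *)
Definition enorm (R : realType) (n : nat) (u : 'cV[R]_n) : R :=
  Num.sqrt (dot u u).

Definition axis (R : realType) (n : nat) (q1 q2 : 'cV[R]_n) : 'cV[R]_n :=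
  (enorm (q1 - q2))^-1 *: (q1 - q2).

Definition is_hyperplane (R : realType) (n : nat) (A : set 'cV[R]_n) : Prop :=
  exists (a : 'cV[R]_n) (b : R), a != 0 /\ A = [set x | dot a x = b].

Definition paraboloid (R : realType) (n : nat) (A : set 'cV[R]_n)
    (q1 q2 : 'cV[R]_n) : set 'cV[R]_n :=
  [set x | A x /\ enorm (q1 - x) = dot (axis q1 q2) (x - q2)].

Definition ellipsoid (R : realType) (n : nat) (A : set 'cV[R]_n)
    (q1 q2 : 'cV[R]_n) (alpha : R) : set 'cV[R]_n :=
  [set x | A x /\ enorm (q2 - x) + enorm (q1 - x) = 2 * alpha].

Definition is_paraboloid_in (R : realType) (n : nat)
    (A S : set 'cV[R]_n) : Prop :=
  is_hyperplane A /\
  exists q1 q2 : 'cV[R]_n, [/\ A q1, A q2, q1 != q2 & S = paraboloid A q1 q2].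

Definition is_ellipsoid_in (R : realType) (n : nat)
    (A S : set 'cV[R]_n) : Prop :=
  is_hyperplane A /\
  exists (q1 q2 : 'cV[R]_n) (alpha : R),
    [/\ A q1, A q2, 0 < alpha, enorm (q1 - q2) < 2 * alpha
      & S = ellipsoid A q1 q2 alpha].

Section DotTheory.
Context {R : realType} {n : nat}.
Implicit Types (u w x y : 'cV[R]_n) (a : R).

Lemma dotC u w : dot u w = dot w u.
Proof.
by rewrite /dot !mxE; apply: eq_bigr => i _; rewrite !mxE mulrC.
Qed.

Lemma dotDr u w x : dot u (w + x) = dot u w + dot u x.
Proof. by rewrite /dot mulmxDr mxE. Qed.

Lemma dotZr a u w : dot u (a *: w) = a * dot u w.
Proof. by rewrite /dot -scalemxAr mxE. Qed.

Lemma dotNr u w : dot u (- w) = - dot u w.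
Proof. by rewrite /dot mulmxN mxE. Qed.

Lemma dotDl u w x : dot (u + w) x = dot u x + dot w x.
Proof. by rewrite !(dotC _ x) dotDr. Qed.

Lemma dotZl a u w : dot (a *: u) w = a * dot u w.
Proof. by rewrite !(dotC _ w) dotZr. Qed.

Lemma dotNl u w : dot (- u) w = - dot u w.
Proof. by rewrite !(dotC _ w) dotNr. Qed.

Lemma dot_ge0 u : 0 <= dot u u.
Proof.
by rewrite /dot mxE; apply: sumr_ge0 => i _; rewrite mxE -expr2 sqr_ge0.
Qed.

Lemma dot_eq0 u : dot u u = 0 -> u = 0.
Proof.
rewrite /dot mxE => /eqP; rewrite psumr_eq0 => [/allP u0|i _]; last first.
  by rewrite mxE -expr2 sqr_ge0.
apply/matrixP => i j; rewrite ord1 [RHS]mxE; apply/eqP.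
by have := u0 i (mem_index_enum i); rewrite mxE -expr2 sqrf_eq0.
Qed.

Lemma enorm_gt0 u : u != 0 -> 0 < enorm u.
Proof.
move=> u0; rewrite sqrtr_gt0 lt_neqAle dot_ge0 andbT eq_sym.
by apply: contra u0 => /eqP/dot_eq0 ->.
Qed.

Lemma sqr_enorm u : enorm u ^+ 2 = dot u u.
Proof. by rewrite sqr_sqrtr ?dot_ge0. Qed.

Lemma enormN u : enorm (- u) = enorm u.
Proof. by rewrite /enorm dotNl dotNr opprK. Qed.

Lemma projE u w :
  (u^T *m (1%:M - w *m w^T) *m u) ord0 ord0 = dot u u - dot w u ^+ 2.
Proof.
rewrite mulmxBr mulmx1 mulmxBl mxE [X in _ + X]mxE -/(dot u u).
rewrite !mulmxA -mulmxA [X in _ - X]mxE big_ord1 -/(dot u w) -/(dot w u).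
by rewrite (dotC u w) expr2.
Qed.

End DotTheory.

(* The focal description of a paraboloid agrees with its quadratic equation. *)
Lemma paraboloidE (R : realType) (n : nat) (p1 p2 : 'cV[R]_n) :
  p1 != p2 ->
  let v := axis p1 p2 in
  let c0 := 2^-1 *: (p1 + p2) in
  let c := 2^-1 * enorm (p1 - p2) in
  paraboloid setT p1 p2 =
  [set x | ((x - c0)^T *m (1%:M - v *m v^T) *m (x - c0)) ord0 ord0
           = 4 * c * dot v (x - c0)].
Proof.
move=> p12 v c0 c.
have N0 : 0 < enorm (p1 - p2) by rewrite enorm_gt0 // subr_eq0.
have c_gt0 : 0 < c by rewrite /c; lra.
have vE : p1 - p2 = (2 * c) *: v.
  by rewrite /v /axis scalerA /c mulrA divff ?pnatr_eq0 // mul1r divff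
    ?scale1r // gt_eqF.
have vv : dot v v = 1.
  rewrite /v /axis dotZl dotZr -sqr_enorm; field; exact: lt0r_neq0.
have p1E : p1 = c0 + c *: v.
  apply/matrixP => i j; move/matrixP/(_ i j): vE; rewrite !mxE => E; lra.
have p2E : p2 = c0 - c *: v.
  apply/matrixP => i j; move/matrixP/(_ i j): vE; rewrite !mxE => E; lra.
rewrite /paraboloid -/v; clearbody v c c0.
apply/seteqP; split => x; rewrite /= projE; last move=> E.
  case=> _; set y := x - c0.
  have -> : p1 - x = c *: v - y.
    by rewrite p1E /y; apply/matrixP => i j; rewrite !mxE; ring.
  have -> : x - p2 = y + c *: v.
    by rewrite p2E /y; apply/matrixP => i j; rewrite !mxE; ring.
  clearbody y; move=> /(congr1 (fun t => t ^+ 2)); rewrite sqr_enorm.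
  rewrite !(dotDl, dotDr, dotNl, dotNr, dotZl, dotZr) vv (dotC y v) => E; nra.
split => //; move: E; set y := x - c0 => E.
have -> : p1 - x = c *: v - y.
  by rewrite p1E /y; apply/matrixP => i j; rewrite !mxE; ring.
have -> : x - p2 = y + c *: v.
  by rewrite p2E /y; apply/matrixP => i j; rewrite !mxE; ring.
clearbody y.
have proj_ge0 : 0 <= dot y y - dot v y ^+ 2.
  have := dot_ge0 (y - dot v y *: v).
  rewrite !(dotDl, dotDr, dotNl, dotNr, dotZl, dotZr) vv (dotC y v); nra.
have s0 : 0 <= dot v y.
  by move: proj_ge0; rewrite E pmulr_rge0 // mulr_gt0.
rewrite dotDr dotZr vv mulr1 /enorm.
have -> : dot (c *: v - y) (c *: v - y) = (dot v y + c) ^+ 2.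
  rewrite !(dotDl, dotDr, dotNl, dotNr, dotZl, dotZr) vv (dotC y v); nra.
by rewrite sqrtr_sqr ger0_norm // addr_ge0 // ltW.
Qed.

(* An ellipsoid is symmetric about the midpoint of its foci and misses that
   midpoint, so it is never a single point.  A tangent hyperplane, which meets
   a paraboloid in one point, therefore does not cut out an ellipsoid. *)
Lemma ellipsoid_not_singleton (R : realType) (n : nat) (A S : set 'cV[R]_n) :
  is_ellipsoid_in A S -> ~ exists x, S = [set x].
Proof.
move=> [[a [b [_ ->]]] [q1 [q2 [alpha [/= Aq1 Aq2 _ lt_al ->]]]]] [x E].
have [/= Ax xE] : ellipsoid [set x | dot a x = b] q1 q2 alpha x by rewrite E.
have : ellipsoid [set x | dot a x = b] q1 q2 alpha (q1 + q2 - x).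
  split; first by rewrite /= !dotDr dotNr Aq1 Aq2 Ax; ring.
  rewrite -xE addrC; congr (_ + _); rewrite -enormN; congr enorm;
    by apply/matrixP => i j; rewrite !mxE; ring.
rewrite E /= => q.
have {}q : q1 + q2 = 2 *: x by rewrite -[LHS](subrK x) q scaler_nat mulr2n.
have x1 : q1 - x = 2^-1 *: (q1 - q2).
  apply/matrixP => i j; move/matrixP/(_ i j): q; rewrite !mxE => q; lra.
have x2 : q2 - x = - (2^-1 *: (q1 - q2)).
  apply/matrixP => i j; move/matrixP/(_ i j): q; rewrite !mxE => q; lra.
have half : enorm (2^-1 *: (q1 - q2)) = 2^-1 * enorm (q1 - q2).
  rewrite /enorm dotZl dotZr mulrA -expr2 sqrtrM ?sqr_ge0 // sqrtr_sqr.
  by rewrite ger0_norm // invr_ge0.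
move: xE; rewrite x1 x2 enormN half => xE; lra.
Qed.

(* Main.v *)
(** In the hyperplane put [r := v - (h . v) h], the projection of the axis, so
[r . r = rho ^+ 2].  If [rho = 1] then [r = v], and the section is the paraboloid with
the same [v] and [c] and shifted vertex.  If [rho < 1], completing the square
moves the center to a point [m], and with [w := x - m] the section becomes
[w . w - (r . w) ^+ 2 = K]; this is the ellipsoid with foci [m + a r] and [m - a r]
and eccentricity [rho], where [a ^+ 2 = K / (1 - r . r)].  [K <= 0] would
leave at most one point. *)
Require Import Defs.
From mathcomp Require Import all_boot all_order all_algebra.
From mathcomp Require Import boolp classical_sets reals.
From mathcomp Require Import ring lra.

Set Implicit Arguments.
Unset Strict Implicit.
Unset Printing Implicit Defensive.

Import Order.TTheory GRing.Theory Num.Theory.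
Local Open Scope ring_scope.
Local Open Scope classical_set_scope.

(** The vector [(u . u) w - (u . w) u] has squared norm [u . u] times the difference of the two
    sides. Cancelling that factor needs [u != 0]. *)
Lemma cauchy_schwarz (R : realType) (n : nat) (u w : 'cV[R]_n) :
  dot u w ^+ 2 <= dot u u * dot w w.
Proof.
have [->|u0] := eqVneq u 0.
  have E z : dot (0 : 'cV[R]_n) z = 0 by rewrite -(scale0r z) dotZl mul0r.
  by rewrite !E expr0n mul0r.
have uu_gt0 : 0 < dot u u by rewrite -sqr_enorm exprn_gt0 // enorm_gt0.
have := dot_ge0 (dot u u *: w - dot u w *: u).
rewrite !(dotDl, dotDr, dotNl, dotNr, dotZl, dotZr) (dotC w u) => H.
rewrite -subr_ge0 -(pmulr_rge0 _ uu_gt0).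
by apply: le_trans H _; rewrite le_eqVlt; apply/orP; left; apply/eqP; ring.
Qed.

(** The squares of the two distances differ by [4 a (r . w)], so distances with sum [2 a] must be
    [a + r . w] and [a - r . w]; squaring one gives the quadric. Conversely, the quadric turns both
    squared distances into the squares of these numbers. *)
Lemma focal_sumE (R : realType) (n : nat) (r w : 'cV[R]_n) (a : R) :
  0 < a -> dot r r < 1 ->
  enorm (w + a *: r) + enorm (w - a *: r) = 2 * a <->
  dot w w - dot r w ^+ 2 = a ^+ 2 * (1 - dot r r).
Proof.
move=> a_gt0 r1.
have plusE : dot (w + a *: r) (w + a *: r)
    = dot w w + 2 * a * dot r w + a ^+ 2 * dot r r.
  by rewrite !(dotDl, dotDr, dotZl, dotZr) (dotC w r); ring.
have minusE : dot (w - a *: r) (w - a *: r)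
    = dot w w - 2 * a * dot r w + a ^+ 2 * dot r r.
  by rewrite !(dotDl, dotDr, dotNl, dotNr, dotZl, dotZr) (dotC w r); ring.
split=> [E|E].
  move: plusE minusE; rewrite -!(sqr_enorm (_ + _)).
  move: E; set S := enorm (w + _); set D := enorm (w - _).
  move=> E SE DE.
  have DS : D = 2 * a - S by lra.
  have {}DS : S = a + dot r w.
    apply: (mulfI (lt0r_neq0 a_gt0)); move: DE; rewrite DS => DE; lra.
  by move: SE; rewrite DS => SE; lra.
(* The roots of [(a + r . w) ^+ 2] and [(a - r . w) ^+ 2] sum to [2 a] only if [|r . w| <= a], which
   Cauchy-Schwarz yields on the quadric. *)
have CS := cauchy_schwarz r w.
have rw_le : dot r w ^+ 2 <= a ^+ 2.
  have ww : dot w w = dot r w ^+ 2 + a ^+ 2 * (1 - dot r r) by lra.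
  rewrite ww in CS.
  have d_gt0 : 0 < 1 - dot r r by lra.
  have : dot r w ^+ 2 * (1 - dot r r) <= a ^+ 2 * dot r r * (1 - dot r r) by lra.
  rewrite ler_pM2r // => /le_trans; apply.
  by rewrite ler_piMr ?sqr_ge0 // ltW.
have : `|dot r w| <= a.
  by rewrite -(ler_pXn2r (n := 2)) ?nnegrE ?(ltW a_gt0) // real_normK ?num_real.
rewrite ler_norml => /andP[rw1 rw2].
rewrite /enorm plusE minusE.
have -> : dot w w + 2 * a * dot r w + a ^+ 2 * dot r r = (a + dot r w) ^+ 2 by lra.
have -> : dot w w - 2 * a * dot r w + a ^+ 2 * dot r r = (a - dot r w) ^+ 2 by lra.
by rewrite !sqrtr_sqr !ger0_norm; lra.
Qed.

Lemma is_ellipsoid_in_quadric (R : realType) (n : nat) (A S : set 'cV[R]_n)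
    (h m r : 'cV[R]_n) (K : R) :
  h != 0 -> A = [set x | dot h (x - m) = 0] -> dot h r = 0 -> dot r r < 1 ->
  S = [set x | A x /\ dot (x - m) (x - m) - dot r (x - m) ^+ 2 = K] ->
  S !=set0 -> ~ (exists x, S = [set x]) ->
  is_ellipsoid_in A S.
Proof.
move=> h0 AE hr r1 SE [x0 Sx0] nsing.
have d_gt0 : 0 < 1 - dot r r by lra.
have K_gt0 : 0 < K.
  (* By Cauchy-Schwarz, [(1 - r . r) (w . w) <= K] with [w := x - m], so [K <= 0] forces [x = m]. *)
  rewrite ltNge; apply/negP => K_le0; apply: nsing; exists m.
  have Sm x : S x -> x = m.
    rewrite SE => -[_ E]; apply/eqP; rewrite -subr_eq0; apply/eqP/dot_eq0.
    have CS := cauchy_schwarz r (x - m).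
    apply/eqP; rewrite eq_le dot_ge0 andbT -(pmulr_rle0 _ d_gt0); lra.
  apply/seteqP; split=> x /=; first exact: Sm.
  by move=> ->; rewrite -(Sm _ Sx0).
set a := Num.sqrt (K / (1 - dot r r)).
have a_gt0 : 0 < a by rewrite sqrtr_gt0 divr_gt0.
have aE : a ^+ 2 * (1 - dot r r) = K.
  by rewrite sqr_sqrtr ?divfK ?gt_eqF // ltW // divr_gt0.
clearbody a; split.
  exists h, (dot h m); split=> //; rewrite AE; apply/seteqP.
  by split=> x /=; rewrite dotDr dotNr => E; lra.
exists (m + a *: r), (m - a *: r), a; split=> //.
- by rewrite AE /= addrC addKr dotZr hr mulr0.
- by rewrite AE /= addrC addKr dotNr dotZr hr mulr0 oppr0.
(* The foci are [2 a] times the length of [r] apart, and [r] is shorter than 1. For [r = 0] they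
   coincide and the section is a sphere. *)
- have -> : m + a *: r - (m - a *: r) = (2 * a) *: r.
    by apply/matrixP => i j; rewrite !mxE; ring.
  rewrite -(ltr_pXn2r (n := 2)) ?nnegrE ?sqrtr_ge0 //; last lra.
  rewrite sqr_enorm dotZl dotZr.
  have := mulr_gt0 a_gt0 a_gt0; nra.
- rewrite SE /ellipsoid; apply/seteqP.
  have q2E x : m - a *: r - x = - (x - m + a *: r).
    by apply/matrixP => i j; rewrite !mxE; ring.
  have q1E x : m + a *: r - x = - (x - m - a *: r).
    by apply/matrixP => i j; rewrite !mxE; ring.
  split=> x /= [Ax E]; split=> //; move: E; rewrite q1E q2E !enormN -aE.
    by move/(focal_sumE (x - m) a_gt0 r1).
  by move/(focal_sumE (x - m) a_gt0 r1).
Qed.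

Theorem mainTheorem5 (R : realType) (n : nat)
    (p1 p2 c0 v : 'cV[R]_n) (c : R) (P : set 'cV[R]_n)
    (h : 'cV[R]_n) (hh : R) (HP : set 'cV[R]_n) (rho : R)
    (hp : p1 != p2)
    (hv : v = axis p1 p2)
    (hc0 : c0 = 2^-1 *: (p1 + p2))
    (hc : c = 2^-1 * enorm (p1 - p2))
    (hP : P = [set x : 'cV[R]_n |
      ((x - c0)^T *m (1%:M - v *m v^T) *m (x - c0)) ord0 ord0
      = 4 * c * dot v (x - c0)])
    (hh1 : enorm h = 1)
    (hHP : HP = [set x : 'cV[R]_n | dot h (x - c0) = hh])
    (hne : (P `&` HP) !=set0)
    (hrho : rho = Num.sqrt (1 - dot h v ^+ 2)) :
  (rho = 1 -> is_paraboloid_in HP (P `&` HP)) /\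
  (rho < 1 -> ~ (exists x, P `&` HP = [set x]) ->
   is_ellipsoid_in HP (P `&` HP)).
Proof.
have hh0 : dot h h = 1 by rewrite -sqr_enorm hh1 expr1n.
have h0 : h != 0.
  by apply: contra_eq_neq hh0 => ->; rewrite -(scale0r h) dotZl mul0r eq_sym oner_eq0.
have N0 : 0 < enorm (p1 - p2) by rewrite enorm_gt0 // subr_eq0.
have c_gt0 : 0 < c by rewrite hc; lra.
have vv : dot v v = 1.
  rewrite hv /axis dotZl dotZr -sqr_enorm; field; exact: lt0r_neq0.
have v_le1 : dot h v ^+ 2 <= 1.
  by have := cauchy_schwarz h v; rewrite hh0 vv mulr1.
have rho2 : rho ^+ 2 = 1 - dot h v ^+ 2 by rewrite hrho sqr_sqrtr // subr_ge0.
have rho_ge0 : 0 <= rho by rewrite hrho sqrtr_ge0.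
have PE x : P x <->
    dot (x - c0) (x - c0) - dot v (x - c0) ^+ 2 = 4 * c * dot v (x - c0).
  by rewrite hP /= projE.
clear hv hc0 hc hP hrho hh1; clear p1 p2 hp N0.
split=> [rho1|rho1 nsing].
  (* The axis is parallel to the hyperplane. *)
  have k0 : dot h v = 0.
    by apply/eqP; rewrite -sqrf_eq0; apply/eqP; move: rho2; rewrite rho1 expr1n; lra.
  split.
    exists h, (hh + dot h c0); split=> //; rewrite hHP; apply/seteqP.
    by split=> x /=; rewrite dotDr dotNr => E; lra.
  (* The new vertex. Moving by [hh *: h] into [HP] adds [hh ^+ 2] to the left side of the equation.
     A shift along [v] leaves that side alone and changes the right side by [4 c] times its length,
     so this length absorbs the constant. *)
  set m := c0 + hh *: h + (hh ^+ 2 / (4 * c)) *: v.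
  have q12E : m + c *: v - (m - c *: v) = (2 * c) *: v.
    by apply/matrixP => i j; rewrite !mxE; ring.
  have q12N : enorm (m + c *: v - (m - c *: v)) = 2 * c.
    rewrite q12E /enorm dotZl dotZr vv mulr1 -expr2 sqrtr_sqr ger0_norm //; lra.
  have q12V : axis (m + c *: v) (m - c *: v) = v.
    rewrite /axis q12N q12E scalerA mulVf ?scale1r //; apply: lt0r_neq0; lra.
  have q12 : m + c *: v != m - c *: v.
    rewrite -subr_eq0 q12E; apply: contra_eq_neq vv => /eqP.
    rewrite scaler_eq0 => /orP[/eqP|/eqP ->]; first lra.
    by rewrite -(scale0r h) dotZl mul0r eq_sym oner_eq0.
  have mh : dot h (m - c0) = hh.
    rewrite /m !(dotDl, dotDr, dotNl, dotNr, dotZl, dotZr) k0 hh0; ring.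
  exists (m + c *: v), (m - c *: v); split=> //.
  - by rewrite hHP /= addrAC dotDr mh dotZr k0 mulr0 addr0.
  - by rewrite hHP /= addrAC dotDr mh dotNr dotZr k0 mulr0 oppr0 addr0.
  (* Viewed as a paraboloid of the whole space cut by [HP], the target can be put in quadratic form
     by [paraboloidE]. *)
  have -> : paraboloid HP (m + c *: v) (m - c *: v)
      = paraboloid setT (m + c *: v) (m - c *: v) `&` HP.
    by apply/seteqP; split=> x /=; rewrite /paraboloid /=; tauto.
  rewrite paraboloidE // q12V q12N.
  have -> : 2^-1 *: (m + c *: v + (m - c *: v)) = m.
    by apply/matrixP => i j; rewrite !mxE; lra.
  have key x : HP x -> (P x <->
      dot (x - m) (x - m) - dot v (x - m) ^+ 2 = 4 * c * dot v (x - m)).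
    rewrite PE hHP /= => hx.
    have -> : x - m = (x - c0) - hh *: h - (hh ^+ 2 / (4 * c)) *: v.
      by apply/matrixP => i j; rewrite /m !mxE; ring.
    move: hx; set y := x - c0 => hy; clearbody y.
    rewrite !(dotDl, dotDr, dotNl, dotNr, dotZl, dotZr).
    rewrite (dotC v h) (dotC y h) (dotC y v) hy k0 hh0 vv.
    have := divfK (lt0r_neq0 (mulr_gt0 (ltr0n R 4 : 0 < 4%:R) c_gt0)) (hh ^+ 2).
    set t := hh ^+ 2 / (4 * c) => tE; split=> E; nra.
  have cE : 4 * (2^-1 * (2 * c)) = 4 * c by field.
  by apply/seteqP; split=> x [] /= Px HPx; split=> //; move: Px;
    rewrite projE cE => /(key _ HPx).
have k2 : 0 < dot h v ^+ 2.
  have : rho ^+ 2 < 1 by rewrite expr_lt1.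
  lra.
set k := dot h v in k2 rho2 v_le1.
(* With [x - c0 = hh h + t r + w] and [h . w = 0], the terms linear in [r . w] have coefficient
   [2 (t k ^+ 2 - k hh - 2 c)]. This [t] makes it vanish, and the remaining constants form the [K]
   passed to [is_ellipsoid_in_quadric]. *)
set t := (k * hh + 2 * c) / k ^+ 2.
have tE : t * k ^+ 2 = k * hh + 2 * c by rewrite divfK // lt0r_neq0.
clearbody t.
have [r rE] : exists r, r = v - k *: h by exists (v - k *: h).
have [m mE] : exists m, m = c0 + hh *: h + t *: r by exists (c0 + hh *: h + t *: r).
have hr : dot h r = 0.
  by rewrite rE dotDr dotNr dotZr hh0 mulr1 subrr.
have rr : dot r r = 1 - k ^+ 2.
  rewrite {1}rE dotDl dotNl dotZl hr mulr0 oppr0 addr0 rE dotDr dotNr dotZr.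
  by rewrite vv (dotC v h) -/k expr2.
have hm x : dot h (x - m) = dot h (x - c0) - hh.
  rewrite mE !(dotDr, dotNr, dotZr) hr hh0; ring.
apply: (@is_ellipsoid_in_quadric _ _ _ _ h m r
  (t ^+ 2 * (1 - k ^+ 2) * k ^+ 2 - (hh ^+ 2 * (1 - k ^+ 2) - 4 * c * k * hh))) => //.
- by rewrite hHP; apply/seteqP; split=> x /=; rewrite hm => E; lra.
- by rewrite rr; lra.
have key x : HP x -> (P x <-> dot (x - m) (x - m) - dot r (x - m) ^+ 2
    = t ^+ 2 * (1 - k ^+ 2) * k ^+ 2
      - (hh ^+ 2 * (1 - k ^+ 2) - 4 * c * k * hh)).
  rewrite PE hHP /= => hx.
  have hw : dot h (x - m) = 0 by rewrite hm hx subrr.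
  have -> : x - c0 = (x - m) + hh *: h + t *: r.
    by apply/matrixP => i j; rewrite mE !mxE; ring.
  have -> : v = r + k *: h by rewrite rE subrK.
  move: hw; set w := x - m => hw; clearbody w.
  rewrite !(dotDl, dotDr, dotZl, dotZr).
  rewrite (dotC w h) (dotC w r) (dotC r h) hw hr rr hh0.
  (* Eliminating [c] in favour of [t] avoids the division by [k ^+ 2]. *)
  have {}tE : 2 * c = t * k ^+ 2 - k * hh by lra.
  have -> : 4 * c = 2 * (t * k ^+ 2 - k * hh) by lra.
  split=> E; lra.
by apply/seteqP; split=> x [] /= Px HPx; split=> //; apply/key.
Qed.
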